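(* Let $p\ge 5$ be a prime and $\mathbf{F}$ a field of characteristic $p$. Choose a basis $\{X_1,X_2,X_3,X_4\}$ of $V_4^*$ with $\Delta(X_i)=X_{i-1}$ for $i>1$ and $\Delta(X_1)=0$, and use the graded reverse lexicographic order with $X_1<X_2<X_3<X_4$. Then a reduced Gröbner basis for the Hilbert ideal of $V_4$ is given by $\{X_1,X_2^2,X_2X_3^{p-3},X_3^{p-1},X_4^p\}$; the corresponding monomial basis for $\mathbf{F}[V_4]_{\mathbf{Z}/p}$ is given by the monomial factors (divisors) of $x_3^{p-2}x_4^{p-1}$ and of $x_2x_3^{p-4}x_4^{p-1}$; and the Hilbert series of $\mathbf{F}[V_4]_{\mathbf{Z}/p}$ is $(1 +2(t+t^2+\cdots +t^{p-3})+t^{p-2})(1+t+\cdots +t^{p-1})$.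
   Context: For $n\le p$, $V_n$ is the $n$-dimensional indecomposable representation over $\mathbf{F}$ of the cyclic group $\mathbf{Z}/p=\langle\sigma\rangle$ on which $\sigma$ acts by a single Jordan block with eigenvalue $1$. The action on $V_n^*$ extends to algebra automorphisms of $\mathbf{F}[V_n]=S(V_n^* )$; $\Delta:=\sigma-1$. The Hilbert ideal is the ideal of $\mathbf{F}[V_n]$ generated by all homogeneous invariants of positive degree, and the ring of coinvariants $\mathbf{F}[V_n]_{\mathbf{Z}/p}$ is the quotient of $\mathbf{F}[V_n]$ by the Hilbert ideal, with its induced grading. Lower case letters denote images in the coinvariants of the variables written in upper case. The monomial basis corresponding to a Gröbner basis consists of the images of the monomials not divisible by any leading monomial of the Gröbner basis. *)

(* Defs.v *)
From HB Require Import structures.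
From mathcomp Require Import all_boot all_order all_algebra.
From mathcomp Require Import generic_quotient ring_quotient boolp mpoly.

Set Implicit Arguments.
Unset Strict Implicit.
Unset Printing Implicit Defensive.

Import GRing.Theory.
Local Open Scope ring_scope.
Local Open Scope quotient_scope.

Section Action.
Variables (F : fieldType) (n : nat).

(* F[V_n] = S(V_n^* ) is the polynomial ring {mpoly F[n]} on the basis
   X_1, ..., X_n of V_n^*.  Indices are shifted by one: X_i is 'X_(i-1), so
   the sum below is X_(i-1), or 0 (an empty sum) when i = 1. *)
Definition delta_var (i : 'I_n) : {mpoly F[n]} := \sum_(j < n | j.+1 == i) 'X_j.

Definition sigma (f : {mpoly F[n]}) : {mpoly F[n]} :=
  f \mPo [tuple 'X_i + delta_var i | i < n].

Definition Delta (f : {mpoly F[n]}) : {mpoly F[n]} := sigma f - f.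

Lemma sigmaX i : sigma 'X_i = 'X_i + delta_var i.
Proof. by rewrite /sigma comp_mpolyXU -tnth_nth tnth_mktuple. Qed.

Lemma DeltaX i : Delta 'X_i = delta_var i.
Proof. by rewrite /Delta sigmaX addrC addKr. Qed.

Lemma delta_var0 (i : 'I_n) : i = 0%N :> nat -> delta_var i = 0.
Proof. by move=> i0; rewrite /delta_var i0 big_pred0. Qed.

Lemma delta_varS (i j : 'I_n) : i = j.+1 :> nat -> delta_var i = 'X_j.
Proof.
move=> ij; rewrite /delta_var (bigD1 j) ?ij //= big1 ?addr0 // => k.
by case/andP=> /eqP[kj]; rewrite -val_eqE /= kj eqxx.
Qed.

Fact sigma_is_monoid_morphism : monoid_morphism sigma.
Proof. by split=> [|f g]; rewrite /sigma ?rmorph1 ?rmorphM. Qed.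

HB.instance Definition _ := GRing.Linear.copy sigma (comp_mpoly
  [tuple 'X_i + delta_var i | i < n]).
HB.instance Definition _ := GRing.isMonoidMorphism.Build
  {mpoly F[n]} {mpoly F[n]} sigma sigma_is_monoid_morphism.

Fact Delta_is_zmod_morphism : zmod_morphism Delta.
Proof. by move=> f g; rewrite /Delta raddfB opprD addrACA -opprD. Qed.

HB.instance Definition _ := GRing.isZmodMorphism.Build
  {mpoly F[n]} {mpoly F[n]} Delta Delta_is_zmod_morphism.

Lemma iter_sigmaE k f :
  iter k sigma f = \sum_(j < k.+1) iter j Delta f *+ 'C(k, j).
Proof.
elim: k => [|k IHk]; first by rewrite big_ord1.
have -> : iter k.+1 sigma f = iter k sigma f + Delta (iter k sigma f).
  by rewrite /Delta addrC subrK.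
rewrite IHk raddf_sum /= big_ord_recl [in RHS]big_ord_recl /= !bin0 -addrA.
congr (_ + _); under [in RHS]eq_bigr => j _ do rewrite /bump /= add1n binS mulrnDr.
rewrite [RHS]big_split /= [X in _ = X + _]big_ord_recr /= bin_small // mulr0n addr0.
by congr (_ + _); apply: eq_bigr => j _; rewrite raddfMn.
Qed.

Lemma iter_DeltaX k (i : 'I_n) : (i < k)%N -> iter k Delta 'X_i = 0.
Proof.
elim: k i => [//|k IHk] i ik; rewrite iterSr DeltaX.
have iter0 : iter k Delta 0 = 0.
  by elim: (k) => //= m ->; exact: raddf0.
case: i ik => -[|i] lti /=.
  by move=> _; rewrite delta_var0.
move=> ik; rewrite (@delta_varS _ (Ordinal (ltnW lti))) //; exact: IHk.
Qed.

(* sigma generates an action of Z/p as soon as n <= p = char F. *)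
Lemma sigma_order p f : p \in [pchar F] -> (n <= p)%N -> iter p sigma f = f.
Proof.
move=> charFp le_np; have p_pr := pcharf_prime charFp.
have pR (g : {mpoly F[n]}) : g *+ p = 0.
  by rewrite -scaler_nat (pcharf0 charFp) scale0r.
have iterX i : iter p sigma 'X_i = 'X_i.
  rewrite iter_sigmaE big_ord_recl /= bin0 big1 ?addr0 // => -[j /= lt_jp] _.
  rewrite /bump /= add1n -/(iter j.+1 Delta _).
  have [lt_j1p|le_pj1] := ltnP j.+1 p; last first.
    by rewrite iter_DeltaX ?mul0rn // (leq_trans (ltn_ord i)) // (leq_trans le_np).
  have /dvdnP[q ->] : (p %| 'C(p, j.+1))%N by rewrite prime_dvd_bin.
  by rewrite mulrnA pR.
suff -> : iter p sigma f = f \mPo [tuple iter p sigma 'X_i | i < n].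
  rewrite -[RHS]comp_mpoly_id; congr (comp_mpoly _ _).
  by apply: eq_mktuple => i.
elim: (p) => [|k IHk] /=; first by rewrite comp_mpoly_id.
rewrite IHk !comp_mpolyE linear_sum /=; apply: eq_bigr => m _.
rewrite linearZ rmorph_prod; congr (_ *: _); apply: eq_bigr => i _.
by rewrite rmorphXn /= !tnth_mktuple.
Qed.

End Action.

Section HilbertIdeal.
Variables (p : nat) (F : fieldType) (n : nat).
Implicit Types f g : {mpoly F[n]}.

(* 'Z_p is Z/p only for p > 1; k acts as sigma^k, see sigma_order. *)
Definition invariant f : Prop := forall k : 'Z_p, iter k (@sigma F n) f = f.

Definition hilbert_generator f : Prop :=
  exists2 d, (0 < d)%N & f \is d.-homog /\ invariant f.

Definition in_generated_ideal (R : comNzRingType) (S : R -> Prop) (f : R) : Prop :=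
  exists2 s : seq (R * R),
    {in s, forall ag, S ag.2} & f = \sum_(ag <- s) ag.1 * ag.2.

(* A boolean predicate, as {ideal_quot _} requires, by classical reflection
   of membership in the generated ideal. *)
Definition hilbert_ideal : {pred {mpoly F[n]}} :=
  fun f => `[< in_generated_ideal hilbert_generator f >].

Fact hilbert_ideal_closed : idealr_closed hilbert_ideal.
Proof.
split.
- by apply/asboolP; exists [::]; rewrite ?big_nil.
- apply/negP => /asboolP[s Ss /(congr1 (mcoeff 0%MM))].
  rewrite mcoeff1 eqxx raddf_sum /= big1_seq; first exact/eqP/oner_neq0.
  move=> [a g] /= /Ss[d d_gt0 [/dhomogP homg _]]; rewrite rmorphM /=.
  rewrite (_ : g@_0 = 0) ?mulr0 //; apply/memN_msupp_eq0/negP => /homg d0.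
  by move: d_gt0; rewrite -d0 mf0.
- move=> a f g /asboolP[s Ss ->] /asboolP[t St ->]; apply/asboolP.
  exists ([seq (a * ag.1, ag.2) | ag <- s] ++ t).
    by move=> x; rewrite mem_cat => /orP[/mapP[y /Ss ? ->]|/St].
  rewrite big_cat big_map mulr_sumr; congr (_ + _).
  by apply: eq_bigr => x _; rewrite mulrA.
Qed.

HB.instance Definition _ :=
  isIdealr.Build {mpoly F[n]} hilbert_ideal hilbert_ideal_closed.

Definition coinvariants : Type := {ideal_quot hilbert_ideal}.
HB.instance Definition _ := GRing.ComNzRing.on coinvariants.

Definition coinv (f : {mpoly F[n]}) : coinvariants := \pi_{ideal_quot hilbert_ideal} f.

Lemma coinv_is_zmod_morphism : zmod_morphism coinv.
Proof. exact: (raddfB (\pi_{ideal_quot hilbert_ideal})). Qed.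
Lemma coinv_is_monoid_morphism : monoid_morphism coinv.
Proof. exact: (pi_is_monoid_morphism {ideal_quot hilbert_ideal}). Qed.

HB.instance Definition _ :=
  GRing.isZmodMorphism.Build {mpoly F[n]} coinvariants coinv coinv_is_zmod_morphism.
HB.instance Definition _ :=
  GRing.isMonoidMorphism.Build {mpoly F[n]} coinvariants coinv coinv_is_monoid_morphism.

Lemma coinv_eq0 f : (coinv f == 0) = (f \in hilbert_ideal).
Proof. by rewrite -[0](rmorph0 coinv) -Quotient.idealrBE subr0. Qed.

Definition coinv_scale (c : F) (x : coinvariants) : coinvariants := coinv c%:MP * x.

Fact coinv_scaleA a b x : coinv_scale a (coinv_scale b x) = coinv_scale (a * b) x.
Proof. by rewrite /coinv_scale mulrA -rmorphM mpolyCM. Qed.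
Fact coinv_scale1 : left_id 1 coinv_scale.
Proof. by move=> x; rewrite /coinv_scale mpolyC1 rmorph1 mul1r. Qed.
Fact coinv_scaleDr : right_distributive coinv_scale +%R.
Proof. by move=> a x y; exact: mulrDr. Qed.
Fact coinv_scaleDl x : {morph coinv_scale^~ x : a b / a + b}.
Proof. by move=> a b; rewrite /coinv_scale mpolyCD rmorphD mulrDl. Qed.
HB.instance Definition _ := GRing.Zmodule_isLmodule.Build F coinvariants
  coinv_scaleA coinv_scale1 coinv_scaleDr coinv_scaleDl.

Lemma coinvZ c f : coinv (c *: f) = c *: coinv f.
Proof. by rewrite -mul_mpolyC rmorphM. Qed.

Definition coinv_graded (d : nat) (x : coinvariants) : Prop :=
  exists2 f, f \is d.-homog & x = coinv f.

End HilbertIdeal.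

Section LinearAlgebra.
Variables (K : fieldType) (V : lmodType K).

(* The vectors b i, for the indices i with P i, form a basis of the
   subspace U of V; in particular they are pairwise distinct. *)
Definition is_basis (I : eqType) (P : I -> Prop) (b : I -> V) (U : V -> Prop) : Prop :=
  [/\ forall i, P i -> U (b i),
      forall (s : seq I) (c : I -> K), uniq s -> {in s, forall i, P i} ->
        \sum_(i <- s) c i *: b i = 0 -> {in s, forall i, c i = 0}
    & forall v, U v -> exists s : seq I, exists c : I -> K,
        [/\ uniq s, {in s, forall i, P i} & v = \sum_(i <- s) c i *: b i]].

Definition has_dim (U : V -> Prop) (k : nat) : Prop :=
  exists b : 'I_k -> V, is_basis (fun=> True) b U.

End LinearAlgebra.

(* For Hilbert series that are polynomials: H`_d is the dimension in degree d. *)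
Definition has_hilbert_series (p : nat) (F : fieldType) (n : nat) (H : {poly nat}) : Prop :=
  forall d, has_dim (@coinv_graded p F n d) (H`_d)%R.

Section Groebner.
Variables (F : fieldType) (n : nat).
Implicit Types (f g : {mpoly F[n]}) (m : 'X_{1..n}) (lt : rel 'X_{1..n}).
Implicit Types (I : {pred {mpoly F[n]}}) (G : seq {mpoly F[n]}).

(* Graded reverse lexicographic order with X_1 < X_2 < ... < X_n: in equal
   degree, the monomial with the larger exponent in the smallest variable
   where the two differ is the smaller one.  The order that mpoly puts on
   'X_{1..n}, and hence mlead, is not this one: it compares exponents in the
   opposite direction, which makes it graded lexicographic. *)
Definition grevlex : rel 'X_{1..n} := fun m1 m2 =>
  (mdeg m1 < mdeg m2)%N || (mdeg m1 == mdeg m2) &&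
    [exists i : 'I_n, (m2 i < m1 i)%N && [forall j : 'I_n, (j < i)%N ==> (m1 j == m2 j)]].

Definition is_lead lt f m : bool :=
  (m \in msupp f) && all (fun m' => (m' == m) || lt m' m) (msupp f).

Definition groebner_basis lt I G : Prop :=
  {subset G <= I} /\
  forall f, f \in I -> f != 0 -> exists g mg mf,
    [/\ g \in G, is_lead lt g mg, is_lead lt f mf & (mg <= mf)%MM].

Definition reduced_groebner_basis lt I G : Prop :=
  [/\ groebner_basis lt I G,
      {in G, forall g, exists2 m, is_lead lt g m & g@_m = 1}
    & {in G &, forall g h, g != h ->
        forall mh, is_lead lt h mh -> {in msupp g, forall m, ~~ (mh <= m)%MM}}].

Definition standard_monomial lt G m : Prop :=
  forall g mg, g \in G -> is_lead lt g mg -> ~~ (mg <= m)%MM.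

End Groebner.

(* X 1, ..., X 4 with the indices 1, ..., 4 of the basis of V_4^*. *)
Definition Xmon (i : nat) : 'X_{1..4} := U_(inord i.-1)%MM.
Definition X (F : fieldType) (i : nat) : {mpoly F[4]} := 'X_[Xmon i].

(* Main.v *)
Require Import Defs.
From mathcomp Require Import all_boot all_order all_algebra.
From mathcomp Require Import boolp zify ring mpoly.

Set Implicit Arguments.
Unset Strict Implicit.
Unset Printing Implicit Defensive.

Import GRing.Theory.
Local Open Scope ring_scope.

(* Write J for the monomial ideal generated by G.

   J contains the Hilbert ideal: let f be a homogeneous invariant of positive
   degree, seen as a function on V_4, on which sigma acts by
   T v = (v_1, v_2 + v_1, v_3 + v_2, v_4 + v_3).  The family of points
     c(e, y, z, s) = (6e, 2 + 6e(y+1), 2y+1 + e(2y^2+3y+z+1), z + eyz + s)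
   satisfies T c(e, y, z, s) = c(e, y+1, z+2y+1, s), hence T^(2k) maps
   c(e, -k, 0, s) to c(e, k, 0, s), and f takes the same value at both.  The
   coefficient of s^b e^j in f(c(e, y, 0, s)) is therefore a polynomial in y
   that agrees with its reflection at all points of the prime field, so its odd
   coefficients vanish if its degree is less than p.  The coefficient of
   X_3^a X_4^b contributes to y^a for j = 0 and to y^(a+1) for j = 1, and one of
   these powers is odd: so it vanishes for 0 < a <= p-2, and then likewise the
   one of X_2 X_3^a X_4^b for a <= p-4.  For X_4^b with 0 < b < p,
   compare f at (0, 0, e, 1) and at its image (0, 0, e, 1 + e).

   The Hilbert ideal contains J: the invariants X_1,
   X_2^2 - X_1 (2 X_3 + X_2), the transfers of X_4^(p-2) and X_4^(p-1), and the
   product of the orbit of X_4 have nonzero coefficients on the successive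
   generators of J, and by the first part their other monomials are multiples
   of the previous generators. *)

Lemma big_ord4 (R : Type) (idx : R) (op : Monoid.law idx) (F : 'I_4 -> R) :
  \big[op/idx]_(i < 4) F i =
    op (F (inord 0)) (op (F (inord 1)) (op (F (inord 2)) (F (inord 3)))).
Proof.
rewrite !big_ord_recl big_ord0 Monoid.mulm1.
by do !congr (op _ _); congr F; apply: val_inj; rewrite /= inordK.
Qed.

(** * Evaluation at points and the action of sigma on them *)

Section Evaluation.
Variables (F : fieldType) (n : nat) (R : comNzRingType) (c : {rmorphism F -> R}).

Definition sigma_point (v : 'I_n -> R) (i : 'I_n) : R :=
  v i + \sum_(j < n | j.+1 == i) v j.

Lemma eq_mmap (v w : 'I_n -> R) (f : {mpoly F[n]}) :
  v =1 w -> mmap c v f = mmap c w f.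
Proof. by move=> vw; apply: eq_bigr => m _; rewrite (mmap1_eq _ vw). Qed.

Lemma mmap_sigma (v : 'I_n -> R) (f : {mpoly F[n]}) :
  mmap c v (sigma f) = mmap c (sigma_point v) f.
Proof.
rewrite /sigma comp_mpolyE rmorph_sum [RHS]/mmap; apply: eq_bigr => m _.
rewrite /= mmapZ rmorph_prod; congr (_ * _); apply: eq_bigr => i _.
rewrite rmorphXn tnth_mktuple /=; congr (_ ^+ _).
rewrite mmapD mmapX mmap1U rmorph_sum; congr (_ + _).
by apply: eq_bigr => j _; rewrite /= mmapX mmap1U.
Qed.

Lemma mmap_iter_sigma k (v : 'I_n -> R) (f : {mpoly F[n]}) :
  mmap c v (iter k (@sigma F n) f) = mmap c (iter k sigma_point v) f.
Proof. by elim: k v => //= k IH v; rewrite mmap_sigma IH -iterSr. Qed.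

Lemma rmorph_mmap (S : comNzRingType) (d : {rmorphism F -> S})
    (phi : {rmorphism R -> S}) (v : 'I_n -> R) (f : {mpoly F[n]}) :
  (forall x, phi (c x) = d x) ->
  phi (mmap c v f) = mmap d (phi \o v) f.
Proof.
move=> phic; rewrite /mmap rmorph_sum; apply: eq_bigr => m _.
rewrite rmorphM phic rmorph_prod; congr (_ * _); apply: eq_bigr => i _.
by rewrite rmorphXn.
Qed.

End Evaluation.

(** * The curve and its reflection symmetry *)

Section Curve.
Variables (F : fieldType) (R : comNzRingType) (c : {rmorphism F -> R}).

Definition curve (e y z s : R) (i : 'I_4) : R :=
  nth 0 [:: 6 * e; 2 + 6 * e * (y + 1);
            2 * y + 1 + e * (2 * y ^+ 2 + 3 * y + z + 1); z + e * y * z + s] i.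

Lemma sigma_curve e y z s :
  sigma_point (curve e y z s) =1 curve e (y + 1) (z + 2 * y + 1) s.
Proof.
case=> -[|[|[|[|//]]]] lti; rewrite /sigma_point big_mkcond big_ord4 /= /curve;
  rewrite ?inordK //=; ring.
Qed.

Lemma eq_sigma_point n (v w : 'I_n -> R) :
  v =1 w -> sigma_point v =1 sigma_point w.
Proof. by move=> vw i; rewrite /sigma_point vw; congr (_ + _); apply: eq_bigr. Qed.

Lemma iter_sigma_curve k e y z s :
  iter k (@sigma_point 4 R) (curve e y z s) =1
    curve e (y + k%:R) (z + 2 * k%:R * y + k%:R ^+ 2) s.
Proof.
elim: k => [|k IH] i /=; first by congr (curve _ _ _ _ _); ring.
rewrite (eq_sigma_point IH) sigma_curve; congr (curve _ _ _ _ _); ring.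
Qed.

(** The step (y, z) -> (y + 1, z + 2y + 1) preserves z - y^2, so the 2k steps from y = -k to y = k
    bring z = 0 back to 0. *)
Lemma sigma_fixed_curve (f : {mpoly F[4]}) e s k : sigma f = f ->
  mmap c (curve e (- k%:R) 0 s) f = mmap c (curve e k%:R 0 s) f.
Proof.
move=> ff; have fk j : iter j (@sigma F 4) f = f by elim: j => //= j ->.
rewrite -{1}(fk (2 * k)%N) mmap_iter_sigma; apply: eq_mmap => i.
rewrite iter_sigma_curve; congr (curve _ _ _ _ _); rewrite natrM; ring.
Qed.

End Curve.

Lemma curve_rmorph (R S : comNzRingType) (phi : {rmorphism R -> S}) e y z s :
  phi \o curve e y z s =1 curve (phi e) (phi y) (phi z) (phi s).
Proof.
case=> -[|[|[|[|//]]]] lti; rewrite /curve /=;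
  rewrite ?(rmorphD, rmorphM, rmorphXn, rmorph1, rmorph_nat) //.
Qed.

(** * Polynomials that are even on the prime field *)

Lemma natr_inj_pchar (p : nat) (F : fieldType) : p \in [pchar F] ->
  {in gtn p &, injective (fun k : nat => k%:R : F)}.
Proof.
move=> charFp.
have inj k l : (k <= l)%N -> (l < p)%N -> k%:R = l%:R :> F -> k = l.
  move=> le_kl lt_lp /eqP; rewrite eq_sym -subr_eq0 -natrB // -(dvdn_pcharf charFp).
  case: (posnP (l - k)) => [|gt0 /dvdn_leq]; first by lia.
  by move=> /(_ gt0); lia.
move=> k l; rewrite !inE => lt_kp lt_lp kl.
by case/orP: (leq_total k l) => le; [|apply/esym]; apply: inj.
Qed.

(** The polynomial [r] is q(X) - q(-X). It vanishes at the p elements of the prime field and has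
    size at most p, so it is zero; its odd coefficients are twice those of q, and 2 is
    invertible. *)
Lemma even_poly_pchar (p : nat) (F : fieldType) (q : {poly F}) :
  p \in [pchar F] -> (2 < p)%N -> (size q <= p)%N ->
  (forall k : nat, q.[- k%:R] = q.[k%:R]) -> forall i, odd i -> q`_i = 0.
Proof.
move=> charFp p_gt2 size_q qN i odd_i.
pose r := \poly_(i < size q) ((1 - (-1) ^+ i) * q`_i).
have r_root k : root r k%:R.
  apply/rootP; rewrite horner_poly; move/eqP: (qN k); rewrite eq_sym -subr_eq0.
  rewrite !horner_coef -sumrB => /eqP H; rewrite -[RHS]H; apply: eq_bigr => j _.
  by rewrite [in RHS]exprNn; set s := (-1) ^+ j; set t := k%:R ^+ j; ring.
have r0 : r = 0.
  apply: contraTeq (size_poly (size q) (fun i => (1 - (-1) ^+ i) * q`_i)) => nz_r.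
  rewrite -ltnNge (leq_ltn_trans size_q) //.
  rewrite -[X in (X < _)%N](size_iota 0 p) -(size_map (fun k => k%:R : F)).
  apply: max_poly_roots => //; first by apply/allP => x /mapP[k _ ->].
  rewrite map_inj_in_uniq ?iota_uniq // => k l; rewrite !mem_iota => lt_kp lt_lp.
  exact: (natr_inj_pchar charFp).
have [lt_i|] := ltnP i (size q); last exact: nth_default.
have := congr1 (fun s : {poly F} => s`_i) r0; rewrite coef_poly lt_i coef0.
rewrite -signr_odd odd_i expr1 opprK => /eqP; rewrite mulf_eq0 => /orP[|/eqP//].
by rewrite -(natrD _ 1 1) -(dvdn_pcharf charFp) => /dvdn_leq; lia.
Qed.

Lemma natr_neq0_pchar (p : nat) (F : fieldType) k :
  p \in [pchar F] -> (0 < k < p)%N -> k%:R != 0 :> F.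
Proof.
move=> charFp /andP[k0 kp]; rewrite -(dvdn_pcharf charFp).
by apply/negP => /(dvdn_leq k0); rewrite leqNgt kp.
Qed.

(** * Values on the curve, expanded in s, e and y *)

Section Slice.
Variables (F : fieldType) (R : comNzRingType) (c : {rmorphism F -> R}).

(** At z = 0 the last coordinate of the curve is s and the others are free of s, so a monomial
    contributes only to the power of s given by its exponent of X_4. *)
Lemma coef_mmap_curve (e y : R) (f : {mpoly F[4]}) b :
  (mmap (polyC \o c) (curve e%:P y%:P 0 'X) f)`_b =
  \sum_(m <- msupp f | m (inord 3) == b) c f@_m * mmap1 (curve e y 0 1) m.
Proof.
rewrite /mmap coef_sum [RHS]big_mkcond; apply: eq_bigr => m _ /=.
rewrite coefCM /mmap1 !big_ord4 /curve !inordK //= !mulr0 !add0r expr1n.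
set P := _ ^+ m (inord 0); set Q := _ ^+ m (inord 1); set S := _ ^+ m (inord 2).
have -> : P * (Q * (S * 'X^(m (inord 3)))) =
    (mmap1 (curve e y 0 1) m)%:P * 'X^(m (inord 3)).
  rewrite /mmap1 big_ord4 /curve !inordK //= !mulr0 !add0r expr1n mulr1.
  rewrite !(rmorphM, rmorphXn) /= !mulrA; congr (_ ^+ _ * _ ^+ _ * _ ^+ _ * _);
  rewrite ?(rmorphM, rmorphD, rmorphXn, rmorph1, rmorph_nat) /= ?addr0 //; ring.
rewrite coefCM coefXn [b == _]eq_sym; case: eqP => _; last by rewrite !mulr0.
by rewrite !mulr1 /mmap1 big_ord4 /curve !inordK //= !mulr0 !add0r expr1n !mulr1.
Qed.
End Slice.

(** The binomial expansion to first order in ['X], which plays the role of e on the curve: values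
    there are studied modulo e^2. *)
Lemma coef_1DXw_exp (R : comNzRingType) (w : R) n :
  ((1 + 'X * w%:P) ^+ n)`_0 = 1 /\ ((1 + 'X * w%:P) ^+ n)`_1 = w *+ n.
Proof.
elim: n => [|n [IH0 IH1]]; first by rewrite expr0 !coef1.
rewrite exprSr coef0M IH0 coefM big_ord_recl big_ord1 /= IH0 IH1.
rewrite !coefD !coefXM !coef1 /= ?coefC /=; split; first by rewrite mul1r addr0.
by rewrite mulrSr; ring.
Qed.

(* [curve_mon m] is the value of the monomial m on the curve at z = 0, without
   the power of s; e is the outer variable and y the inner one. *)
Section CurveMonomial.
Variable F : fieldType.

Definition curve_mon (m : 'X_{1..4}) : {poly {poly F}} :=
  mmap1 (curve 'X 'X%:P 0 1) m.

(** The coefficient in [curve_mon m] of the lowest possible power of e, whose exponent is that of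
    X_1 in m. *)
Definition curve_mon0 (m : 'X_{1..4}) : {poly F} :=
  6 ^+ m (inord 0) * 2 ^+ m (inord 1) * (2 * 'X + 1) ^+ m (inord 2).

(** Since 2y^2 + 3y + 1 = (2y + 1)(y + 1), the second and third coordinates at z = 0 factor as 2 (1
    + 3e(y + 1)) and (2y + 1)(1 + e(y + 1)). *)
Lemma curve_monE m : curve_mon m =
  'X ^+ m (inord 0) * ((curve_mon0 m)%:P *
    ((1 + 'X * (3 * ('X + 1))%:P) ^+ m (inord 1) *
     (1 + 'X * ('X + 1)%:P) ^+ m (inord 2))).
Proof.
rewrite /curve_mon /curve_mon0 /mmap1 big_ord4 /curve !inordK //=.
rewrite !mulr0 !add0r expr1n mulr1 addr0.
rewrite [in RHS]polyCM [in RHS]polyCM !polyC_exp.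
have -> : 2 + 6 * 'X * ('X%:P + 1) = 2%:P * (1 + 'X * (3 * ('X + 1))%:P) :> {poly {poly F}}.
  by rewrite !polyCM polyCD !polyC_natr; ring.
have -> : 2 * 'X%:P + 1 + 'X * (2 * 'X%:P ^+ 2 + 3 * 'X%:P + 1) =
    (2 * 'X + 1)%:P * (1 + 'X * ('X + 1)%:P) :> {poly {poly F}}.
  by rewrite !polyCD !polyCM !polyC_natr; ring.
rewrite -[6 in LHS]polyC_natr !exprMn.
set a := _%:P ^+ _; set b := _%:P ^+ _; set w := _%:P ^+ _.
set x := 'X ^+ _; set u := (1 + _) ^+ m (inord 1); set v := (1 + _) ^+ m (inord 2).
ring.
Qed.

Lemma coef_curve_mon m :
  (curve_mon m)`_0 = curve_mon0 m *+ (m (inord 0) == 0%N) /\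
  (curve_mon m)`_1 = if m (inord 0) == 0%N
    then curve_mon0 m * ('X + 1) *+ (3 * m (inord 1) + m (inord 2))
    else curve_mon0 m *+ (m (inord 0) == 1%N).
Proof.
rewrite curve_monE !coefXnM !coefCM coef0M.
have [a0 a1] := coef_1DXw_exp (3 * ('X + 1) : {poly F}) (m (inord 1)).
have [b0 b1] := coef_1DXw_exp ('X + 1 : {poly F}) (m (inord 2)).
case: (m (inord 0)) => [|[|k]] //=.
  rewrite coefM big_ord_recl big_ord1 /= a0 a1 b0 b1; split; first by rewrite !mulr1.
  by rewrite mul1r mulr1 mulr_natl mulrDr !mulrnAr -mulrnA -mulrnDr addnC.
by rewrite coef0M a0 b0 !mulr1.
Qed.

Lemma size_curve_mon0 m : (size (curve_mon0 m) <= (m (inord 2)).+1)%N.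
Proof.
rewrite /curve_mon0 -!natrX -natrM mulr_natl -scaler_nat.
rewrite (leq_trans (size_scale_leq _ _)) // (leq_trans (size_poly_exp_leq _ _)) // ltnS.
rewrite -[X in (_ <= X)%N]mul1n leq_mul2r; apply/orP; right.
have: (size (2 * 'X + 1 : {poly F})%R <= 2)%N; last by case: size.
rewrite -polyC_natr mul_polyC (leq_trans (size_polyD _ _)) // geq_max.
by rewrite (leq_trans (size_scale_leq _ _)) ?size_polyX ?size_poly1.
Qed.

(** A factor X_1 lowers the bound by one. This keeps the multiples of X_1 away from the power of y
    at which the coefficient of X_2 X_3^a X_4^b is read off. *)
Lemma size_curve_mon m :
  (size ((curve_mon m)`_0)%R <= m (inord 2) + (m (inord 0) == 0%N))%N /\
  (size ((curve_mon m)`_1)%R <= (m (inord 2) + (m (inord 0) == 0%N)).+1)%N.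
Proof.
have s0 := size_curve_mon0 m; have [-> ->] := coef_curve_mon m.
case: eqP => [_|_]; rewrite ?mulr1n ?mulr0n ?size_poly0 ?addn1 ?addn0; split=> //.
  rewrite -scaler_nat (leq_trans (size_scale_leq _ _)) //.
  by rewrite (leq_trans (size_polyMleq _ _)) // size_XaddC addn2.
by case: eqP => _; rewrite ?size_poly0 // (leq_trans s0).
Qed.

End CurveMonomial.

Lemma mdeg4 (m : 'X_{1..4}) :
  mdeg m = (m (inord 0) + (m (inord 1) + (m (inord 2) + m (inord 3))))%N.
Proof. by rewrite mdegE big_ord4. Qed.

Lemma mnm4P (m m' : 'X_{1..4}) :
  m (inord 0) = m' (inord 0) -> m (inord 1) = m' (inord 1) ->
  m (inord 2) = m' (inord 2) -> m (inord 3) = m' (inord 3) -> m = m'.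
Proof.
move=> e0 e1 e2 e3; apply/mnmP => i; rewrite -[i]inord_val.
by case: i => -[|[|[|[|//]]]].
Qed.

Section CurveCoefficients.
Variables (F : fieldType) (f : {mpoly F[4]}).

(** The coefficient of s^b e^j in the values of f on the curve at z = 0, a polynomial in y. *)
Definition curve_coef (b j : nat) : {poly F} :=
  \sum_(m <- msupp f | m (inord 3) == b) f@_m *: (curve_mon F m)`_j.

(* Keeping s as a third, outermost variable is what allows monomials with any
   power of X_4. *)
Lemma curve_coefE b j :
  curve_coef b j =
  ((mmap (polyC \o (polyC \o polyC))
     (curve ('X%:P : {poly {poly {poly F}}}) 'X%:P%:P 0 'X) f)`_b)`_j.
Proof.
rewrite coef_mmap_curve coef_sum; apply: eq_bigr => m _.
by rewrite /= coefCM mul_polyC.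
Qed.

Lemma size_curve_coef d b j : f \is d.-homog -> (j < 2)%N ->
  (size (curve_coef b j) <= d - b + j.+1)%N.
Proof.
move=> /dhomogP homf lt_j2; rewrite /curve_coef.
rewrite big_seq_cond; apply: (big_ind (fun q : {poly F} => size q <= d - b + j.+1)%N).
- by rewrite size_poly0.
- by move=> q r sq sr; rewrite (leq_trans (size_polyD _ _)) // geq_max sq.
move=> m /andP[/homf /=]; rewrite mdeg4 => degm /eqP mb.
rewrite (leq_trans (size_scale_leq _ _)) //.
have [s0 s1] := size_curve_mon F m.
case: j lt_j2 => [|[|//]] _; [apply: leq_trans s0 _|apply: leq_trans s1 _];
  by case: eqP => ?; lia.
Qed.

(** By [sigma_fixed_curve] this polynomial in y takes equal values at -k and k, and its degree is at
    most d - b + j, hence less than p. *)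
Lemma curve_coef_odd p d b j i : p \in [pchar F] -> (2 < p)%N -> sigma f = f ->
  f \is d.-homog -> (j < 2)%N -> (d - b + j < p)%N -> odd i ->
  (curve_coef b j)`_i = 0.
Proof.
move=> charFp p_gt2 ff homf lt_j2 lt_p; apply: (even_poly_pchar charFp) => //.
  by rewrite (leq_trans (size_curve_coef b homf lt_j2)) // addnS.
move=> k.
(* [phi x] specializes the innermost variable y to x, leaving s and e free. *)
pose phi x := map_poly (map_poly (horner_eval x)) : {poly {poly {poly F}}} -> {poly {poly F}}.
have phiE (x : F) : (curve_coef b j).[x] =
    ((mmap (polyC \o polyC) (curve ('X%:P : {poly {poly F}}) x%:P%:P 0 'X) f)`_b)`_j.
  rewrite curve_coefE.
  transitivity ((phi x (mmap (polyC \o (polyC \o polyC))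
     (curve ('X%:P : {poly {poly {poly F}}}) 'X%:P%:P 0 'X) f))`_b`_j).
    by rewrite !coef_map.
  rewrite /phi (@rmorph_mmap _ _ _ _ _ (polyC \o polyC)); last first.
    move=> y; rewrite /= map_polyC /=; congr polyC.
    exact: etrans (map_polyC (horner_eval x) _) (congr1 polyC (hornerC _ _)).
  congr (nth 0 (polyseq (nth 0 (polyseq _) b)) j); apply: eq_mmap => l.
  rewrite curve_rmorph.
  congr (curve _ _ _ _ l); rewrite /= ?map_polyX ?map_polyC /= ?map_polyX ?raddf0 //.
  by rewrite map_polyC /=; congr (_%:P%:P); exact: hornerX.
by rewrite !phiE !rmorphN /= !polyC_natr (sigma_fixed_curve _ _ _ _ ff).
Qed.

Lemma curve_coef_single (m : 'X_{1..4}) j i :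
  (forall m', m' \in msupp f -> m' (inord 3) = m (inord 3) -> m' != m ->
     ((curve_mon F m')`_j)`_i = 0) ->
  (curve_coef (m (inord 3)) j)`_i = f@_m * ((curve_mon F m)`_j)`_i.
Proof.
move=> others; rewrite /curve_coef coef_sum big_mkcond.
have zero m' : m' \in msupp f -> m' != m ->
    (if m' (inord 3) == m (inord 3) then (f@_m' *: (curve_mon F m')`_j)`_i else 0) = 0.
  by move=> m'f m'm; case: eqP => // e; rewrite coefZ others ?mulr0.
have [mf|mNf] := boolP (m \in msupp f).
  rewrite (bigD1_seq m) ?msupp_uniq //= eqxx coefZ big1_seq ?addr0 //.
  by move=> m' /andP[m'm m'f]; apply: zero.
rewrite memN_msupp_eq0 // mul0r big1_seq // => m' /= m'f; apply: zero => //.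
by apply: contraNneq mNf => <-.
Qed.

End CurveCoefficients.

(** * Top coefficients in y *)

Section TopCoefficient.
Variable F : fieldType.

Lemma coef_curve_mon0 (m : 'X_{1..4}) :
  (curve_mon0 F m)`_(m (inord 2)) =
    6 ^+ m (inord 0) * 2 ^+ m (inord 1) * 2 ^+ m (inord 2).
Proof.
have nat_expr (R : nzRingType) :
    6 ^+ m (inord 0) * 2 ^+ m (inord 1) = (6 ^ m (inord 0) * 2 ^ m (inord 1))%:R :> R.
  by rewrite natrM !natrX.
rewrite /curve_mon0 2!nat_expr -[(_ ^ _ * _)%:R in LHS]polyC_natr coefCM; congr (_ * _).
have size_lin n : (size ((2 * 'X + 1 : {poly F}) ^+ n)%R <= n.+1)%N.
  (* The power (2y + 1)^n is [curve_mon0] of the monomial X_3^n. *)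
  have := size_curve_mon0 F [multinom (if i == inord 2 then n else 0%N) | i < 4].
  by rewrite /curve_mon0 !mnmE -!val_eqE /= !inordK //= !expr0 !mul1r.
elim: (m (inord 2)) => [|n IH]; first by rewrite !expr0 coef1.
have top0 : ((2 * 'X + 1 : {poly F}) ^+ n)`_n.+1 = 0 by exact: nth_default.
rewrite exprS mulrDl mul1r coefD top0 addr0 -mulrA -[2 in LHS]polyC_natr coefCM coefXM /=.
by rewrite polyC_natr IH exprS.
Qed.

Lemma coef_curve_mon0_X1 (m : 'X_{1..4}) :
  (curve_mon0 F m * ('X + 1))`_(m (inord 2)).+1 = (curve_mon0 F m)`_(m (inord 2)).
Proof.
rewrite mulrDr mulr1 coefD coefMX /= [X in _ + X]nth_default ?addr0 //.
exact: size_curve_mon0.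
Qed.

End TopCoefficient.

Section CurveTopCoefficients.
Variables (F : fieldType) (f : {mpoly F[4]}) (d : nat).
Hypothesis homf : f \is d.-homog.

Let msupp_deg m : m \in msupp f -> mdeg m = d.
Proof. by move/dhomogP: homf => /[apply]. Qed.

(** Any other monomial of degree d with the same exponent of X_4 has a smaller exponent of X_3, so
    its degree in y is too small. For j = 1 the last factor is the derivative of (1 + e(y + 1))^a in
    e, where a is the exponent of X_3. *)
Lemma curve_coef_X3 (m : 'X_{1..4}) j : mdeg m = d -> (j < 2)%N ->
  m (inord 0) = 0%N -> m (inord 1) = 0%N ->
  (curve_coef f (m (inord 3)) j)`_(m (inord 2) + j) =
    f@_m * (2 ^+ m (inord 2) * (if j == 0%N then 1 else (m (inord 2))%:R)).
Proof.
move=> deg_m lt_j2 m0 m1; rewrite curve_coef_single.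
  have [c0 c1] := coef_curve_mon F m; congr (_ * _).
  case: j lt_j2 => [|[|//]] _; rewrite ?c0 ?c1 ?m0 ?m1 /=.
    by rewrite addn0 mulr1 coef_curve_mon0 ?m0 ?m1 !expr0 !mul1r.
  rewrite muln0 add0n coefMn addn1 coef_curve_mon0_X1 coef_curve_mon0 ?m0 ?m1.
  by rewrite !expr0 !mul1r mulr_natr.
move=> m' m'f m'3 m'm.
have [s0 s1] := size_curve_mon F m'; move: s0 s1.
move: deg_m (msupp_deg m'f); rewrite !mdeg4 => deg_m deg_m'.
have : ~ (m' (inord 0) = 0 /\ m' (inord 1) = 0)%N.
  by case=> m'0 m'1; case/eqP: m'm; apply: mnm4P; lia.
move=> nz s0 s1; case: j lt_j2 => [|[|//]] _; apply: nth_default.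
  by rewrite (leq_trans s0) //; case: eqP; lia.
by rewrite (leq_trans s1) //; case: eqP; lia.
Qed.

(** Besides X_2 X_3^a X_4^b, only X_3^(a+1) X_4^b can reach this power of y, and its coefficient is
    assumed zero. For j = 1 the factor a + 3 collects 3(y + 1) from X_2 and a(y + 1) from X_3^a. *)
Lemma curve_coef_X2X3 (m : 'X_{1..4}) j : mdeg m = d -> (j < 2)%N ->
  m (inord 0) = 0%N -> m (inord 1) = 1%N ->
  f@_(U_(inord 2) *+ (m (inord 2)).+1 + U_(inord 3) *+ m (inord 3))%MM = 0 ->
  (curve_coef f (m (inord 3)) j)`_(m (inord 2) + j) =
    f@_m * (2 ^+ (m (inord 2)).+1 * (if j == 0%N then 1 else (m (inord 2) + 3)%:R)).
Proof.
move=> deg_m lt_j2 m0 m1; set m2 := (_ + _)%MM => f_m2; rewrite curve_coef_single.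
  have [c0 c1] := coef_curve_mon F m; congr (_ * _).
  case: j lt_j2 => [|[|//]] _; rewrite ?c0 ?c1 ?m0 ?m1 /=.
    by rewrite addn0 mulr1 coef_curve_mon0 ?m0 ?m1 expr0 mul1r expr1 exprS.
  rewrite muln1 addnC coefMn addn1 coef_curve_mon0_X1 coef_curve_mon0 ?m0 ?m1.
  by rewrite expr0 mul1r expr1 exprS mulr_natr addnC.
move=> m' m'f m'3 m'm.
have [s0 s1] := size_curve_mon F m'; move: s0 s1.
move: deg_m (msupp_deg m'f); rewrite !mdeg4 => deg_m deg_m'.
have : ~ (m' (inord 0) = 0 /\ m' (inord 1) = 1)%N.
  by case=> m'0 m'1; case/eqP: m'm; apply: mnm4P; lia.
have : ~ (m' (inord 0) = 0 /\ m' (inord 1) = 0)%N.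
  case=> m'0 m'1; have m'm2 : m' = m2.
    apply: mnm4P; rewrite /m2 mnmDE !mulmnE !mnm1E -!val_eqE /= !inordK //=; lia.
  by move: m'f; rewrite m'm2 mcoeff_msupp f_m2 eqxx.
move=> nz nz' s0 s1; case: j lt_j2 => [|[|//]] _; apply: nth_default.
  by rewrite (leq_trans s0) //; case: eqP; lia.
by rewrite (leq_trans s1) //; case: eqP; lia.
Qed.

End CurveTopCoefficients.

(** * Vanishing coefficients of homogeneous invariants *)

Section Support.
Variables (p : nat) (F : fieldType).
Hypotheses (p_ge5 : (5 <= p)%N) (charFp : p \in [pchar F]).
Variables (f : {mpoly F[4]}) (d : nat).
Hypotheses (ff : sigma f = f) (homf : f \is d.-homog).

Let msupp_deg m : m \in msupp f -> mdeg m = d.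
Proof. by move/dhomogP: homf => /[apply]. Qed.

Let pow2_neq0 n : 2 ^+ n != 0 :> F.
Proof. by rewrite expf_neq0 // (natr_neq0_pchar charFp) //; lia. Qed.

Lemma fixed_coef_X3 (m : 'X_{1..4}) :
  m (inord 0) = 0%N -> m (inord 1) = 0%N -> (0 < m (inord 2) <= p - 2)%N ->
  f@_m = 0.
Proof.
move=> m0 m1 m2; have [mf|/memN_msupp_eq0//] := boolP (m \in msupp f).
have deg_m := msupp_deg mf; have := deg_m; rewrite mdeg4 => deg_m4.
(* With this j the exponent of y is odd. When j = 1 the exponent of X_3 also appears as a factor,
   and it is invertible because it lies strictly between 0 and p. *)
pose j : nat := ~~ odd (m (inord 2)).
have lt_j2 : (j < 2)%N by rewrite /j; case: odd.
have odd_i : odd (m (inord 2) + j) by rewrite oddD /j; case: odd.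
have := curve_coef_X3 homf deg_m lt_j2 m0 m1.
rewrite (curve_coef_odd charFp _ ff homf lt_j2 _ odd_i); [|lia|lia].
move=> /esym/eqP; rewrite mulf_eq0 => /orP[/eqP//|].
rewrite (negbTE (mulf_neq0 _ _)) ?pow2_neq0 //.
by case: (j == 0%N); rewrite ?oner_neq0 // (natr_neq0_pchar charFp) //; lia.
Qed.

(** The competing monomial X_3^(a+1) X_4^b is excluded by [fixed_coef_X3]. The factor a + 3 is
    invertible for a <= p - 4 and becomes zero at a = p - 3, where the generator X_2 X_3^(p-3)
    appears. *)
Lemma fixed_coef_X2X3 (m : 'X_{1..4}) :
  m (inord 0) = 0%N -> m (inord 1) = 1%N -> (m (inord 2) <= p - 4)%N ->
  f@_m = 0.
Proof.
move=> m0 m1 m2; have [mf|/memN_msupp_eq0//] := boolP (m \in msupp f).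
have deg_m := msupp_deg mf; have := deg_m; rewrite mdeg4 => deg_m4.
pose j : nat := ~~ odd (m (inord 2)).
have lt_j2 : (j < 2)%N by rewrite /j; case: odd.
have odd_i : odd (m (inord 2) + j) by rewrite oddD /j; case: odd.
have := curve_coef_X2X3 homf deg_m lt_j2 m0 m1; rewrite fixed_coef_X3; last first.
- by rewrite mnmDE !mulmnE !mnm1E -!val_eqE /= !inordK //=; lia.
- by rewrite mnmDE !mulmnE !mnm1E -!val_eqE /= !inordK //=; lia.
- by rewrite mnmDE !mulmnE !mnm1E -!val_eqE /= !inordK //=; lia.
move=> /(_ erefl); rewrite (curve_coef_odd charFp _ ff homf lt_j2 _ odd_i); [|lia|lia].
move=> /esym/eqP; rewrite mulf_eq0 => /orP[/eqP//|].
rewrite (negbTE (mulf_neq0 _ _)) ?pow2_neq0 //.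
by case: (j == 0%N); rewrite ?oner_neq0 // (natr_neq0_pchar charFp) //; lia.
Qed.

(** In f(0, 0, e, 1 + e) - f(0, 0, e, 1) = 0, the monomial X_4^b contributes b to the coefficient of
    e, while a monomial divisible by X_3 contributes only from order 2 on. *)
Lemma fixed_coef_X4 (m : 'X_{1..4}) :
  m (inord 0) = 0%N -> m (inord 1) = 0%N -> m (inord 2) = 0%N ->
  (0 < m (inord 3) < p)%N -> f@_m = 0.
Proof.
move=> m0 m1 m2 m3; have [mf|/memN_msupp_eq0//] := boolP (m \in msupp f).
have := msupp_deg mf; rewrite mdeg4 m0 m1 m2 !add0n => deg_m.
pose v (x : {poly F}) (i : 'I_4) : {poly F} := nth 0 [:: 0; 0; 'X; 1 + x] i.
have sigma_v : sigma_point (v 0) =1 v 'X.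
  case=> -[|[|[|[|//]]]] lti; rewrite /sigma_point big_mkcond big_ord4 /= /v;
    by rewrite ?inordK //= ?(addr0, add0r).
have : (mmap polyC (v 'X) f - mmap polyC (v 0) f)`_1 = 0.
  by rewrite -(eq_mmap _ _ sigma_v) -mmap_sigma ff subrr coef0.
rewrite /mmap -sumrB coef_sum (bigD1_seq m) ?msupp_uniq //= big1_seq.
  rewrite -mulrBr coefCM /mmap1 !big_ord4 /v !inordK //= m0 m1 m2 !expr0 !mul1r.
  have [_ c1] := coef_1DXw_exp (1 : F) (m (inord 3)).
  rewrite !addr0 expr1n coefB coef1 subr0 -['X]mulr1 -polyC1 c1 => /eqP.
  by rewrite mulf_eq0 (negbTE (natr_neq0_pchar charFp _)) // orbF => /eqP.
move=> m' /andP[m'm m'f]; rewrite -mulrBr coefCM /mmap1 !big_ord4 /v !inordK //=.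
rewrite addr0 expr1n !expr0n.
have := msupp_deg m'f; rewrite mdeg4 => deg_m'.
case: eqP => m'0; last by rewrite !mul0r subrr coef0 mulr0.
case: eqP => m'1; last by rewrite !(mul0r, mulr0) subrr coef0 mulr0.
rewrite !mul1r -mulrBr coefXnM.
case m'2: (m' (inord 2)) => [|[|k]] /=; last by rewrite mulr0.
  by case/eqP: m'm; apply: mnm4P; lia.
have [c0 _] := coef_1DXw_exp (1 : F) (m' (inord 3)).
by rewrite subnn coefB coef1 -['X]mulr1 -polyC1 c0 subrr mulr0.
Qed.

(* Indices are shifted: [m (inord i)] is the exponent of X_(i+1). *)
Definition nonstandard (m : 'X_{1..4}) : bool :=
  [|| 0 < m (inord 0), 1 < m (inord 1),
      (0 < m (inord 1)) && (p - 3 <= m (inord 2)),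
      p - 1 <= m (inord 2) | p <= m (inord 3)]%N.

(** A standard monomial of positive degree is X_4^b, X_3^a X_4^b with a > 0, or X_2 X_3^a X_4^b, and
    each shape is excluded by one of the lemmas above. *)
Lemma fixed_msupp : (0 < d)%N -> {in msupp f, forall m, nonstandard m}.
Proof.
move=> d_gt0 m mf; have := msupp_deg mf; rewrite mdeg4 => deg_m.
move: mf; rewrite mcoeff_msupp; apply: contraNT => std_m; apply/eqP.
have [m0 m1] : (m (inord 0) = 0 /\ m (inord 1) <= 1)%N by move: std_m; rewrite /nonstandard; lia.
case m1E: (m (inord 1)) m1 => [|[|//]] _.
  have [m2|m2] := posnP (m (inord 2)).
    by apply: fixed_coef_X4 => //; move: std_m; rewrite /nonstandard; lia.
  by apply: fixed_coef_X3 => //; move: std_m; rewrite /nonstandard; lia.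
by apply: fixed_coef_X2X3 => //; move: std_m; rewrite /nonstandard; lia.
Qed.

End Support.

(** * Transfers, orbit products and monomials of the Hilbert ideal *)

Section SigmaOrbits.
Variables (F : fieldType) (n : nat).

Lemma dhomog_sigma (f : {mpoly F[n]}) d : f \is d.-homog -> sigma f \is d.-homog.
Proof.
move=> /dhomogP homf; rewrite /sigma comp_mpolyE big_seq rpred_sum // => m /homf /= <-.
apply: rpredZ; rewrite mdegE; apply: (big_ind2 (fun (g : {mpoly F[n]}) e => g \is e.-homog)).
- exact: dhomog1.
- by move=> g e h e'; apply: dhomogM.
move=> i _; rewrite tnth_mktuple.
have lin : 'X_i + delta_var F i \is 1.-homog.
  by rewrite rpredD ?dhomogX /= ?mdeg1 // rpred_sum // => j _; rewrite dhomogX /= mdeg1.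
by have := dhomogMn (m i) lin; rewrite mul1n.
Qed.

Lemma dhomog_iter_sigma k (f : {mpoly F[n]}) d :
  f \is d.-homog -> iter k (@sigma F n) f \is d.-homog.
Proof. by move=> homf; elim: k => //= k; apply: dhomog_sigma. Qed.

Variable p : nat.
Hypotheses (charFp : p \in [pchar F]) (le_np : (n <= p)%N).

Lemma sigma_invariant (f : {mpoly F[n]}) : sigma f = f -> Defs.invariant p f.
Proof. by move=> ff k; elim: (k : nat) => //= j ->. Qed.

Lemma invariant_sigma (f : {mpoly F[n]}) : Defs.invariant p f -> sigma f = f.
Proof. by move=> /(_ 1). Qed.

Definition transfer (f : {mpoly F[n]}) := \sum_(k < p) iter k (@sigma F n) f.
Definition orbit_prod (f : {mpoly F[n]}) := \prod_(k < p) iter k (@sigma F n) f.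

Let p_gt0 : (0 < p)%N := prime_gt0 (pcharf_prime charFp).

(** As sigma^p is the identity, sigma permutes the orbit cyclically. Stated for any commutative law,
    this serves both the transfer and the orbit product. *)
Lemma big_sigma_orbit (R : Type) (idx : R) (op : Monoid.com_law idx)
    (h : {mpoly F[n]} -> R) (f : {mpoly F[n]}) :
  \big[op/idx]_(k < p) h (iter k.+1 (@sigma F n) f) =
  \big[op/idx]_(k < p) h (iter k (@sigma F n) f).
Proof.
have := sigma_order f charFp le_np; case: p p_gt0 => // q _ fq.
by rewrite big_ord_recr big_ord_recl /= -iterS fq Monoid.mulmC.
Qed.

Lemma sigma_transfer f : sigma (transfer f) = transfer f.
Proof. by rewrite /transfer raddf_sum (big_sigma_orbit _ id). Qed.

Lemma sigma_orbit_prod f : sigma (orbit_prod f) = orbit_prod f.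
Proof. by rewrite /orbit_prod rmorph_prod (big_sigma_orbit _ id). Qed.

Lemma dhomog_transfer d f : f \is d.-homog -> transfer f \is d.-homog.
Proof. by move=> homf; apply: rpred_sum => k _; apply: dhomog_iter_sigma. Qed.

Lemma dhomog_orbit_prod d f : f \is d.-homog -> orbit_prod f \is (d * p).-homog.
Proof.
move=> homf; rewrite /orbit_prod; elim: p => [|q IH].
  by rewrite big_ord0 muln0 dhomog1.
by rewrite big_ord_recr mulnSr; apply: dhomogM => //; apply: dhomog_iter_sigma.
Qed.

Lemma fixed_in_hilbert_ideal (f : {mpoly F[n]}) d :
  (0 < d)%N -> f \is d.-homog -> sigma f = f -> f \in @hilbert_ideal p F n.
Proof.
move=> d_gt0 homf ff; apply/asboolP; exists [:: (1, f)]; last first.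
  by rewrite big_seq1 /= mul1r.
by move=> ag; rewrite inE => /eqP -> /=; exists d => //; split=> //; apply: sigma_invariant.
Qed.

Lemma hilbert_ideal_monomial_le (m m' : 'X_{1..n}) :
  'X_[m] \in @hilbert_ideal p F n -> (m <= m')%MM -> 'X_[m'] \in @hilbert_ideal p F n.
Proof.
by move=> mI mm'; rewrite -(submK mm') mpolyXD; apply: idealMr.
Qed.

(** Removing from f its other terms, already known to lie in the ideal, leaves a nonzero multiple of
    the monomial m. Each new generator of J is obtained this way from an invariant. *)
Lemma hilbert_ideal_isolate (f : {mpoly F[n]}) m :
  f \in @hilbert_ideal p F n -> f@_m != 0 ->
  (forall m', m' \in msupp f -> m' != m -> 'X_[m'] \in @hilbert_ideal p F n) ->
  'X_[m] \in @hilbert_ideal p F n.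
Proof.
move=> fI fm others.
have mf : m \in msupp f by rewrite mcoeff_msupp.
have : f@_m *: 'X_[m] \in @hilbert_ideal p F n.
  have -> : f@_m *: 'X_[m] =
      f - \sum_(m' <- msupp f | m' != m) f@_m' *: 'X_[m'].
    by rewrite {2}[f]mpolyE (bigD1_seq m) ?msupp_uniq //= addrK.
  rewrite rpredB // big_seq_cond rpred_sum // => m' /andP[m'f m'm].
  by rewrite -mul_mpolyC; apply: idealMr; apply: others.
by move/(idealMr (f@_m)^-1%:MP); rewrite mul_mpolyC scalerA mulVf // scale1r.
Qed.

End SigmaOrbits.

(** * The generators of J lie in the Hilbert ideal *)

Lemma coef_binomial_exp (R : comNzRingType) (a b : R) e i : (i <= e)%N ->
  ((a *: 'X + b%:P) ^+ e)`_i = a ^+ i * b ^+ (e - i) *+ 'C(e, i).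
Proof.
move=> le_ie; rewrite addrC exprDn coef_sum (bigD1 (Ordinal (le_ie : i < e.+1)%N)) //=.
rewrite big1 => [|j neq_ji].
  by rewrite addr0 -polyC_exp exprZn coefMn mul_polyC !coefZ coefXn eqxx mulr1 mulrC.
rewrite -polyC_exp exprZn coefMn mul_polyC !coefZ coefXn.
by rewrite eq_sym -[_ == _]/(j == Ordinal (le_ie : i < e.+1)%N) (negbTE neq_ji) !mulr0 mul0rn.
Qed.

(** The constant term in s and e is the value at s = e = 0, which can be computed for a transfer
    without expanding it in monomials. *)
Lemma curve_coef00 (F : fieldType) (f : {mpoly F[4]}) :
  curve_coef f 0 0 = mmap polyC (curve 0 'X 0 0) f.
Proof.
rewrite /curve_coef big_mkcond; apply: eq_bigr => m _.
have [-> _] := coef_curve_mon F m.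
rewrite /mmap1 big_ord4 /curve !inordK //= /curve_mon0.
rewrite ?(mulr0, mul0r, addr0, add0r) !expr0n -mul_polyC.
case: eqP => [_|_]; case: eqP => [m0|_];
  by rewrite ?m0 ?expr0 ?(mulr1, mul1r, mulr0, mul0r, mulr1n, mulr0n).
Qed.

Section GeneratorsInIdeal.
Variables (p : nat) (F : fieldType).
Hypotheses (p_ge5 : (5 <= p)%N) (charFp : p \in [pchar F]).

Let I := @hilbert_ideal p F 4.

(** After k steps from z = 0 on the curve with e = s = 0, the last coordinate is 2ky + k^2, so the
    transfer takes the value obtained by summing (2ky + k^2)^e over k, where e is now the exponent
    of X_4. *)
Lemma curve_coef00_transfer_X4 e i : (i <= e)%N ->
  (curve_coef (transfer p ('X_(inord 3) ^+ e : {mpoly F[4]})) 0 0)`_i =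
  (2 ^+ i * \sum_(k < p) k%:R ^+ (i + 2 * (e - i))) *+ 'C(e, i).
Proof.
move=> le_ie; rewrite curve_coef00 /transfer raddf_sum coef_sum mulr_sumr -sumrMnl.
apply: eq_bigr => k _; rewrite /= mmap_iter_sigma.
rewrite (eq_mmap _ _ (iter_sigma_curve _ _ _ _ _)) rmorphXn /= mmapX mmap1U.
rewrite /curve inordK //= !(mul0r, addr0, add0r).
have -> : 2 * k%:R * 'X + k%:R ^+ 2 = (2 * k%:R) *: 'X + (k%:R ^+ 2)%:P :> {poly F}.
  by rewrite -mul_polyC polyC_exp polyCM !polyC_natr.
by rewrite coef_binomial_exp // exprMn -exprM exprD mulrA.
Qed.

(** By Fermat each nonzero k contributes 1, and k = 0 contributes 0. The sum is -1 in F, so it is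
    invertible. *)
Lemma sum_natr_expr_pred : \sum_(k < p) k%:R ^+ (p - 1) = (p - 1)%:R :> F.
Proof.
rewrite -(big_mkord xpredT (fun k => k%:R ^+ (p - 1))) big_ltn; last by lia.
rewrite expr0n subn_eq0 leqNgt (leq_trans _ p_ge5) // add0r.
rewrite -(sumr_const_nat p 1); apply: eq_big_nat => k k_range.
have nz : k%:R != 0 :> F by rewrite (natr_neq0_pchar charFp).
apply: (mulfI nz); rewrite mulr1 -exprS subn1 prednK; last by lia.
by rewrite -[_ ^+ p]/(pFrobenius_aut charFp _) pFrobenius_aut_nat.
Qed.

Lemma hilbert_ideal_X1 : 'X_(inord 0) \in I.
Proof.
apply: (@fixed_in_hilbert_ideal _ _ _ _ 1) => //; first by rewrite dhomogX /= mdeg1.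
by rewrite sigmaX delta_var0 ?addr0 ?inordK.
Qed.

Lemma hilbert_ideal_X2X2 : 'X_[U_(inord 1) *+ 2] \in I.
Proof.
(* Opaque names make the variables atoms for [ring]; here [X i] stands for X_(i+1). *)
have [X XE] : exists X : nat -> {mpoly F[4]}, forall i, X i = 'X_(inord i).
  by exists (fun i => 'X_(inord i)).
have homX i : X i \is 1.-homog by rewrite XE dhomogX /= mdeg1.
have sX i : (i < 3)%N -> sigma (X i.+1) = X i.+1 + X i.
  by move=> lti; rewrite !XE sigmaX (@delta_varS _ _ _ (inord i)) // !inordK //; lia.
have sX0 : sigma (X 0%N) = X 0%N by rewrite XE sigmaX delta_var0 ?addr0 ?inordK.
pose q := X 1%N * X 1%N - X 0%N * (X 2%N + X 2%N + X 1%N).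
have qI : q \in I.
  apply: (@fixed_in_hilbert_ideal _ _ _ _ 2) => //.
    have homXX i j : X i * X j \is 2.-homog by exact: dhomogM (homX i) (homX j).
    by rewrite /q !mulrDr rpredB ?rpredD.
  rewrite /q raddfB /= !(rmorphM (@sigma F 4)) /= !raddfD /= sX0 !sX //; ring.
have -> : 'X_[U_(inord 1) *+ 2] = q + (X 2%N + X 2%N + X 1%N) * X 0%N.
  by rewrite -mpolyXn expr2 /q -XE; ring.
by rewrite rpredD // idealMr // XE hilbert_ideal_X1.
Qed.

Let Xn_homog e : ('X_(inord 3) ^+ e : {mpoly F[4]}) \is e.-homog.
Proof. by rewrite -[X in X.-homog]mul1n; apply: dhomogMn; rewrite dhomogX /= mdeg1. Qed.

Let le4p : (4 <= p)%N := ltnW p_ge5.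

Lemma transfer_X4_in_hilbert_ideal e : (0 < e)%N ->
  transfer p ('X_(inord 3) ^+ e : {mpoly F[4]}) \in I.
Proof.
move=> e_gt0; apply: (@fixed_in_hilbert_ideal _ _ _ _ e) => //.
  exact: dhomog_transfer.
exact: sigma_transfer.
Qed.

Lemma hilbert_ideal_X1_X2X2 (m : 'X_{1..4}) :
  ((0 < m (inord 0)) || (1 < m (inord 1)))%N -> 'X_[m] \in I.
Proof.
case/orP => m_gt; [apply: (hilbert_ideal_monomial_le hilbert_ideal_X1)|
  apply: (hilbert_ideal_monomial_le hilbert_ideal_X2X2)];
by apply/mnm_lepP => i; rewrite ?mulmnE mnm1E; case: eqP => // <-.
Qed.

(** In the transfer of X_4^(p-2), the power sum over k met at y^(p-3) has exponent (p - 3) + 2 = p -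
    1, hence is nonzero. In degree p - 2 every other nonstandard monomial is a multiple of X_1 or
    X_2^2. *)
Lemma hilbert_ideal_X2X3 : 'X_[U_(inord 1) + U_(inord 2) *+ (p - 3)] \in I.
Proof.
set m := (_ + _)%MM.
have [m0 m1 m2 m3] : [/\ m (inord 0) = 0, m (inord 1) = 1, m (inord 2) = p - 3
    & m (inord 3) = 0]%N.
  by rewrite /m !mnmDE !mulmnE !mnm1E -!val_eqE /= !inordK //=; split; lia.
pose f := transfer p ('X_(inord 3) ^+ (p - 2) : {mpoly F[4]}).
have homf : f \is (p - 2).-homog by apply: dhomog_transfer.
have ff : sigma f = f by apply: sigma_transfer.
have deg_m : mdeg m = (p - 2)%N by rewrite mdeg4; lia.
apply: (@hilbert_ideal_isolate _ _ _ f); first by apply: transfer_X4_in_hilbert_ideal; lia.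
  have no_X3 : f@_(U_(inord 2) *+ (m (inord 2)).+1 + U_(inord 3) *+ m (inord 3))%MM = 0.
    by apply: (fixed_coef_X3 p_ge5 charFp ff homf);
      rewrite mnmDE !mulmnE !mnm1E -!val_eqE /= !inordK //=; lia.
  have := curve_coef_X2X3 homf deg_m (isT : (0 < 2)%N) m0 m1 no_X3.
  rewrite m3 addn0 curve_coef00_transfer_X4 ?m2; last by lia.
  rewrite (_ : p - 3 + 2 * (p - 2 - (p - 3)) = p - 1)%N; last by lia.
  rewrite (_ : (p - 2 = (p - 3).+1)%N) ?binSn; last by lia.
  rewrite sum_natr_expr_pred => e; apply/eqP => fm0; move/eqP: e; rewrite fm0 mul0r.
  rewrite -mulr_natr !mulf_eq0 expf_eq0 !(negbTE (natr_neq0_pchar charFp _)) ?andbF //; lia.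
move=> m' m'f m'm.
have m'_ns : nonstandard p m' by apply: (fixed_msupp p_ge5 charFp ff homf) => //; lia.
have := dhomog_mf homf m'f; rewrite /= mdeg4 => deg_m'.
apply: hilbert_ideal_X1_X2X2; move: m'_ns; rewrite /nonstandard => m'_ns.
case: ltnP => //= m'0; rewrite ltnNge; apply/negP => m'1.
by case/eqP: m'm; apply: mnm4P; lia.
Qed.

Lemma hilbert_ideal_X2X3_le (m : 'X_{1..4}) :
  (0 < m (inord 1))%N -> (p - 3 <= m (inord 2))%N -> 'X_[m] \in I.
Proof.
move=> m1 m2; apply: (hilbert_ideal_monomial_le hilbert_ideal_X2X3).
apply/mnm_lepP => i; rewrite mnmDE mulmnE !mnm1E.
case: eqP => [<-|_]; case: eqP => [e|_] //; rewrite -?e ?mul1n //.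
by move/(congr1 val): e; rewrite /= !inordK.
Qed.

Lemma hilbert_ideal_X3 : 'X_[U_(inord 2) *+ (p - 1)] \in I.
Proof.
set m := (_ *+ _)%MM.
have [m0 m1 m2 m3] : [/\ m (inord 0) = 0, m (inord 1) = 0, m (inord 2) = p - 1
    & m (inord 3) = 0]%N.
  by rewrite /m !mulmnE !mnm1E -!val_eqE /= !inordK //=; split; lia.
pose f := transfer p ('X_(inord 3) ^+ (p - 1) : {mpoly F[4]}).
have homf : f \is (p - 1).-homog by apply: dhomog_transfer.
have ff : sigma f = f by apply: sigma_transfer.
have deg_m : mdeg m = (p - 1)%N by rewrite mdeg4; lia.
apply: (@hilbert_ideal_isolate _ _ _ f); first by apply: transfer_X4_in_hilbert_ideal; lia.
  have := curve_coef_X3 homf deg_m (isT : (0 < 2)%N) m0 m1.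
  rewrite m3 addn0 curve_coef00_transfer_X4 ?m2; last by lia.
  rewrite subnn muln0 addn0 binn mulr1n sum_natr_expr_pred => e.
  apply/eqP => fm0; move/eqP: e; rewrite fm0 mul0r.
  by rewrite !mulf_eq0 expf_eq0 !(negbTE (natr_neq0_pchar charFp _)) ?andbF //; lia.
move=> m' m'f m'm.
have m'_ns : nonstandard p m' by apply: (fixed_msupp p_ge5 charFp ff homf) => //; lia.
have := dhomog_mf homf m'f; rewrite /= mdeg4 => deg_m'.
have [m'01|] := boolP ((0 < m' (inord 0)) || (1 < m' (inord 1)))%N.
  exact: hilbert_ideal_X1_X2X2.
rewrite negb_or -!leqNgt => /andP[m'0 m'1].
(* In degree p - 1, a nonstandard monomial other than X_3^(p-1) and outside the ideal of X_1 and
   X_2^2 is a multiple of X_2 X_3^(p-3). *)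
have m'1_gt0 : (0 < m' (inord 1))%N.
  rewrite lt0n; apply: contraNneq m'm => m'10; move: m'_ns; rewrite /nonstandard => m'_ns.
  by apply/eqP/mnm4P; lia.
apply: hilbert_ideal_X2X3_le => //; move: m'_ns; rewrite /nonstandard; lia.
Qed.

Lemma nonstandard_lt_hilbert_ideal (m : 'X_{1..4}) :
  nonstandard p m -> (m (inord 3) < p)%N -> 'X_[m] \in I.
Proof.
move=> m_ns m3; have [m01|] := boolP ((0 < m (inord 0)) || (1 < m (inord 1)))%N.
  exact: hilbert_ideal_X1_X2X2.
move=> m01; have [/andP[m1 m2]|m12] := boolP ((0 < m (inord 1)) && (p - 3 <= m (inord 2)))%N.
  exact: hilbert_ideal_X2X3_le.
apply: (hilbert_ideal_monomial_le hilbert_ideal_X3).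
apply/mnm_lepP => i; rewrite mulmnE mnm1E; case: eqP => // <-; rewrite mul1n.
by move: m_ns m01 m12; rewrite /nonstandard; lia.
Qed.

Lemma hilbert_ideal_X4 : 'X_[U_(inord 3) *+ p] \in I.
Proof.
set m := (_ *+ _)%MM.
have [m0 m1 m2 m3] : [/\ m (inord 0) = 0, m (inord 1) = 0, m (inord 2) = 0
    & m (inord 3) = p]%N.
  by rewrite /m !mulmnE !mnm1E -!val_eqE /= !inordK //=; split; lia.
pose f := orbit_prod p ('X_(inord 3) : {mpoly F[4]}).
have homf : f \is p.-homog.
  by rewrite -[X in X.-homog]mul1n; apply: dhomog_orbit_prod; rewrite dhomogX /= mdeg1.
have ff : sigma f = f by apply: sigma_orbit_prod.
have deg_m : mdeg m = p by rewrite mdeg4; lia.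
apply: (@hilbert_ideal_isolate _ _ _ f).
- by apply: (@fixed_in_hilbert_ideal _ _ _ _ p) => //; lia.
(* The point (0, 0, 0, 1) is fixed by T, so every factor of the orbit product equals 1 there, and
   only pure powers of X_4 are nonzero at it. *)
- pose v (i : 'I_4) : F := (i == inord 3)%:R.
  have sigma_v : sigma_point v =1 v.
    move=> i; rewrite /sigma_point big1 ?addr0 // => j /eqP ji; rewrite /v; case: eqP => // j3.
    by have := ltn_ord i; rewrite -ji j3 inordK.
  have iter_v k : iter k (@sigma_point 4 F) v =1 v.
    elim: k => // k IH i /=; rewrite (eq_sigma_point IH); exact: sigma_v.
  have f_v : mmap idfun v f = 1.
    rewrite /f /orbit_prod rmorph_prod big1 // => k _.
    by rewrite /= mmap_iter_sigma (eq_mmap _ _ (iter_v k)) mmapX mmap1U /v eqxx.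
  suff <- : mmap idfun v f = f@_m by rewrite f_v oner_neq0.
  have v_m' m' : m' \in msupp f -> m' != m -> f@_m' * mmap1 v m' = 0.
    move=> m'f m'm; have := dhomog_mf homf m'f; rewrite /= mdeg4 => deg_m'.
    rewrite /mmap1 big_ord4 /v -!val_eqE /= !inordK //= !expr0n.
    case: eqP => m'0; last by rewrite !(mul0r, mulr0).
    case: eqP => m'1; last by rewrite !(mul0r, mulr0).
    case: eqP => m'2; last by rewrite !(mul0r, mulr0).
    by case/eqP: m'm; apply: mnm4P; lia.
  have v_m : mmap1 v m = 1.
    by rewrite /mmap1 big_ord4 /v -!val_eqE /= !inordK //= m0 m1 m2 !expr0 !mul1r expr1n.
  have [mf|mNf] := boolP (m \in msupp f).
    rewrite /mmap (bigD1_seq m) ?msupp_uniq //= v_m mulr1 big1_seq ?addr0 //.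
    by move=> m' /andP[m'm m'f]; apply: v_m'.
  rewrite (memN_msupp_eq0 mNf) /mmap big1_seq // => m' /= m'f; apply: v_m' => //.
  by apply: contraNneq mNf => <-.
move=> m' m'f m'm.
have m'_ns : nonstandard p m' by apply: (fixed_msupp p_ge5 charFp ff homf) => //; lia.
apply: nonstandard_lt_hilbert_ideal m'_ns _.
have := dhomog_mf homf m'f; rewrite /= mdeg4 => deg_m'.
rewrite ltnNge; apply: contraNN m'm => m'3; apply/eqP/mnm4P; lia.
Qed.

Lemma nonstandard_hilbert_ideal m : nonstandard p m -> 'X_[m] \in I.
Proof.
move=> m_ns; have [m3|m3] := ltnP (m (inord 3)) p.
  exact: nonstandard_lt_hilbert_ideal.
apply: (hilbert_ideal_monomial_le hilbert_ideal_X4).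
by apply/mnm_lepP => i; rewrite mulmnE mnm1E; case: eqP => // <-; rewrite mul1n.
Qed.

(** Multiples of nonstandard monomials are nonstandard, so [fixed_msupp] extends from the generating
    invariants to their combinations. The converse holds monomial by monomial. *)
Lemma hilbert_idealE f : f \in I = all (nonstandard p) (msupp f).
Proof.
apply/idP/allP => [/asboolP[s sS ->] m|f_ns].
  rewrite mcoeff_msupp raddf_sum /=; apply: contraNT => m_std; rewrite big_seq big1 // => ag ags.
  have [d d_gt0 [homg inv]] := sS ag ags.
  apply/eqP; rewrite mcoeff_eq0; apply: contraNN m_std => /msuppM_le /allpairsP[[m1 m2] /=].
  move=> [m1a m2g ->].
  have : nonstandard p m2.
    by apply: (fixed_msupp p_ge5 charFp (invariant_sigma inv) homg).
  rewrite /nonstandard !mnmDE; lia.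
rewrite [f]mpolyE big_seq rpred_sum // => m /f_ns m_ns.
by rewrite -mul_mpolyC idealMr // nonstandard_hilbert_ideal.
Qed.

End GeneratorsInIdeal.

(** * Leading monomials for the graded reverse lexicographic order *)

Section Grevlex.
Variable n : nat.
Implicit Types m : 'X_{1..n}.

Lemma grevlex_trans : transitive (@grevlex n).
Proof.
move=> m2 m1 m3 /orP[lt12|/andP[/eqP eq12 /existsP[i /andP[lti /forallP eqi]]]];
  move=> /orP[lt23|/andP[/eqP eq23 /existsP[j /andP[ltj /forallP eqj]]]]; apply/orP.
- by left; apply: ltn_trans lt12 lt23.
- by left; rewrite -eq23.
- by left; rewrite eq12.
right; rewrite eq12 eq23 eqxx /=; apply/existsP.
have eqi' (k : 'I_n) : (k < i)%N -> m1 k = m2 k by move=> ki; apply/eqP/(implyP (eqi k)).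
have eqj' (k : 'I_n) : (k < j)%N -> m2 k = m3 k by move=> kj; apply/eqP/(implyP (eqj k)).
have [ij|ji|/val_inj ij] := ltngtP i j.
- exists i; rewrite -eqj' // lti; apply/forallP => k; apply/implyP => ki.
  by rewrite eqi' // eqj' // (ltn_trans ki).
- exists j; rewrite eqi' // ltj; apply/forallP => k; apply/implyP => kj.
  by rewrite eqi' ?eqj' // (ltn_trans kj).
exists i; rewrite (ltn_trans _ lti) ?ij //; apply/forallP => k; apply/implyP => kj.
by rewrite eqi' ?eqj' // ij.
Qed.

Lemma grevlex_total m1 m2 : m1 != m2 -> grevlex m1 m2 || grevlex m2 m1.
Proof.
move=> m12; rewrite /grevlex [mdeg m2 == _]eq_sym.
case: ltngtP => //= _.
have [i ne_i] : exists i, m1 i != m2 i.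
  by apply/existsP; apply: contraNT m12 => /existsPn eq12; apply/eqP/mnmP => i;
    apply/eqP/negPn.
(* In equal degree, the first index where the exponents differ decides the comparison. *)
case: (@arg_minnP _ i (fun k => m1 k != m2 k) (@nat_of_ord n) ne_i) => j ne_j min_j.
have eq_j (k : 'I_n) : (k < j)%N -> m1 k = m2 k.
  by move=> kj; apply/eqP; apply: contraTT kj => /min_j; rewrite leqNgt.
move: ne_j; rewrite neq_ltn => /orP[lt_j|lt_j]; apply/orP; [right|left];
  apply/existsP; exists j; rewrite lt_j; apply/forallP => k; apply/implyP => kj;
  by rewrite eq_j.
Qed.

Lemma exists_lead (F : fieldType) (f : {mpoly F[n]}) :
  f != 0 -> exists m, is_lead (@grevlex n) f m.
Proof.
rewrite -msupp_eq0 /is_lead; elim: (msupp f) => // m s IH _.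
have [->|/IH[m1 /andP[m1s /allP m1max]]] := eqVneq s [::].
  by exists m; rewrite inE /= eqxx.
have [m1m|m1m] := eqVneq m1 m.
  exists m; rewrite inE /= eqxx /=; apply/allP => m' /m1max; by rewrite m1m.
case/orP: (grevlex_total m1m) => [lt_m1m|lt_mm1]; [exists m|exists m1];
  rewrite inE /= ?eqxx ?m1s ?orbT ?lt_mm1 ?orbT /=; apply/allP => m' /m1max //.
by case/orP => [/eqP->|/grevlex_trans/(_ lt_m1m) ->]; rewrite ?lt_m1m orbT.
Qed.

End Grevlex.

Lemma mnm_le4 (m m' : 'X_{1..4}) : (m <= m')%MM =
  [&& m (inord 0) <= m' (inord 0), m (inord 1) <= m' (inord 1),
      m (inord 2) <= m' (inord 2) & m (inord 3) <= m' (inord 3)]%N.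
Proof.
apply/mnm_lepP/and4P => [le_mm'|[le0 le1 le2 le3] i]; first by split.
by rewrite -[i]inord_val; case: i => -[|[|[|[|//]]]].
Qed.

Lemma XmonE i j : (0 < i <= 4)%N -> (j < 4)%N -> Xmon i (inord j) = (i.-1 == j).
Proof. by move=> *; rewrite /Xmon mnm1E -val_eqE /= !inordK //; lia. Qed.

(** * The reduced Groebner basis and its standard monomials *)

Section Groebner.
Variables (p : nat) (F : fieldType).
Hypotheses (p_ge5 : (5 <= p)%N) (charFp : p \in [pchar F]).

Definition lead_monomials : seq 'X_{1..4} :=
  [:: Xmon 1; (Xmon 2 *+ 2)%MM; (Xmon 2 + Xmon 3 *+ (p - 3))%MM;
      (Xmon 3 *+ (p - 1))%MM; (Xmon 4 *+ p)%MM].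

Definition groebner_seq : seq {mpoly F[4]} :=
  [:: X F 1; X F 2 ^+ 2; X F 2 * X F 3 ^+ (p - 3); X F 3 ^+ (p - 1); X F 4 ^+ p].

Lemma groebner_seqE : groebner_seq = [seq 'X_[m] | m <- lead_monomials].
Proof. by rewrite /groebner_seq /X !mpolyXn -mpolyXD. Qed.

Lemma nonstandardE m : nonstandard p m = has (fun g => (g <= m)%MM) lead_monomials.
Proof.
rewrite /nonstandard /= !mnm_le4 !mnmDE !mulmnE !XmonE //=; lia.
Qed.

Lemma is_leadX m m' : is_lead (@grevlex 4) ('X_[m] : {mpoly F[4]}) m' = (m' == m).
Proof. by rewrite /is_lead msuppX inE /=; case: eqP => // ->; rewrite eqxx. Qed.

Lemma standard_monomialE m :
  standard_monomial (@grevlex 4) groebner_seq m <-> ~~ nonstandard p m.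
Proof.
rewrite nonstandardE groebner_seqE; split=> [std_m|/hasPn std_m g mg].
  by apply/hasPn => g gM; apply: (std_m 'X_[g]); rewrite ?is_leadX ?map_f.
by move=> /mapP[m' m'M ->]; rewrite is_leadX => /eqP->; apply: std_m.
Qed.

Lemma lead_monomials_antichain : {in lead_monomials &, forall a b, a != b -> ~~ (b <= a)%MM}.
Proof.
move=> a b; rewrite !inE.
move=> /or4P[/eqP->|/eqP->|/eqP->|/orP[/eqP->|/eqP->]];
  move=> /or4P[/eqP->|/eqP->|/eqP->|/orP[/eqP->|/eqP->]];
  rewrite ?eqxx // => _; rewrite !mnm_le4 ?mnmDE ?mulmnE !XmonE //=; lia.
Qed.

(** All monomials of an element of the ideal are nonstandard, in particular its leading one. The
    basis is reduced because it consists of monomials none of which divides another. *)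
Lemma reduced_groebner_basis_hilbert_ideal :
  reduced_groebner_basis (@grevlex 4) (@hilbert_ideal p F 4) groebner_seq.
Proof.
rewrite groebner_seqE; split.
- split=> [g /mapP[m mM ->]|f fI nz_f].
    rewrite hilbert_idealE // msuppX /= andbT nonstandardE.
    by apply/hasP; exists m => //; apply: lepm_refl.
  have [mf lead_f] := exists_lead nz_f; have /andP[mf_f _] := lead_f.
  have := allP (etrans (esym (hilbert_idealE p_ge5 charFp f)) fI) _ mf_f.
  rewrite nonstandardE => /hasP[m mM m_mf]; exists 'X_[m], m, mf.
  by split; rewrite ?is_leadX ?map_f.
- by move=> g /mapP[m mM ->]; exists m; rewrite ?is_leadX ?mcoeffX eqxx.
move=> g h /mapP[a aM ->] /mapP[b bM ->] ab mh; rewrite is_leadX => /eqP-> m.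
rewrite msuppX inE => /eqP->; apply: lead_monomials_antichain => //.
by apply: contraNneq ab => ->.
Qed.

(** Standard monomials with exponent 0 of X_2 are the divisors of the first monomial; those with
    exponent 1 divide the second. *)
Lemma standard_monomial_divides m :
  standard_monomial (@grevlex 4) groebner_seq m <->
  (m <= Xmon 3 *+ (p - 2) + Xmon 4 *+ (p - 1))%MM \/
  (m <= Xmon 2 + Xmon 3 *+ (p - 4) + Xmon 4 *+ (p - 1))%MM.
Proof.
rewrite standard_monomialE /nonstandard !mnm_le4 !mnmDE !mulmnE !XmonE //=.
by split; lia.
Qed.

End Groebner.

(** * Monomial basis and Hilbert series of the coinvariants *)

Definition std_mon c a b : 'X_{1..4} := (Xmon 2 *+ c + Xmon 3 *+ a + Xmon 4 *+ b)%MM.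

Lemma std_monE c a b :
  [/\ std_mon c a b (inord 0) = 0, std_mon c a b (inord 1) = c,
      std_mon c a b (inord 2) = a & std_mon c a b (inord 3) = b]%N.
Proof. by rewrite /std_mon !mnmDE !mulmnE !XmonE //=; split; lia. Qed.

Lemma std_mon_inj c : injective (fun ab => std_mon c ab.1 ab.2).
Proof.
move=> [a b] [a' b'] /= e; have [_ _ a_eq b_eq] := std_monE c a b.
have [_ _ a'_eq b'_eq] := std_monE c a' b'.
by move: a_eq b_eq; rewrite e a'_eq b'_eq => -> ->.
Qed.

Section Coinvariants.
Variables (p : nat) (F : fieldType).
Hypotheses (p_ge5 : (5 <= p)%N) (charFp : p \in [pchar F]).

Let cmon (m : 'X_{1..4}) := coinv p ('X_[m] : {mpoly F[4]}).

(** A relation lifts to an element of the ideal supported on standard monomials, which must be zero.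
    The indexing map g covers both the basis indexed by monomials and the bases indexed by ordinals
    that [has_dim] requires. *)
Lemma coinv_standard_free (T : eqType) (g : T -> 'X_{1..4}) (s : seq T) (c : T -> F) :
  uniq s -> {in s &, injective g} -> {in s, forall i, ~~ nonstandard p (g i)} ->
  \sum_(i <- s) c i *: cmon (g i) = 0 -> {in s, forall i, c i = 0}.
Proof.
move=> s_uniq g_inj g_std sum0 i si.
pose f : {mpoly F[4]} := \sum_(j <- s) c j *: 'X_[g j].
have : f \in @hilbert_ideal p F 4.
  rewrite -coinv_eq0 /f raddf_sum -[X in _ == X]sum0; apply/eqP/eq_bigr => j _.
  exact: coinvZ.
rewrite hilbert_idealE // => /allP/(_ (g i)); rewrite (negbTE (g_std i si)).
rewrite mcoeff_msupp /f raddf_sum /= (bigD1_seq i) //= big_seq_cond big1.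
  by rewrite mcoeffZ mcoeffX eqxx mulr1 addr0; case: eqP => // _ /(_ isT).
move=> j /andP[sj ji]; rewrite mcoeffZ mcoeffX; case: eqP => [/g_inj gij|]; last by rewrite mulr0.
by rewrite gij ?eqxx in ji.
Qed.

(** The list s may exceed the support of f, so that in a given degree one list of standard monomials
    serves every f. *)
Lemma coinv_standard_span (f : {mpoly F[4]}) (s : seq 'X_{1..4}) :
  uniq s -> {in msupp f, forall m, ~~ nonstandard p m -> m \in s} ->
  coinv p f = \sum_(m <- s) f@_m *: cmon m.
Proof.
move=> s_uniq fs; apply/eqP; rewrite -subr_eq0.
have -> : \sum_(m <- s) f@_m *: cmon m = coinv p (\sum_(m <- s) f@_m *: 'X_[m]).
  by rewrite raddf_sum; apply: eq_bigr => m _; rewrite /= coinvZ.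
rewrite -raddfB /= coinv_eq0 hilbert_idealE //; apply/allP => m.
have coef_s : (\sum_(m' <- s) f@_m' *: 'X_[m'])@_m = if m \in s then f@_m else 0.
  rewrite raddf_sum /=; case: ifPn => [ms|mNs].
    rewrite (bigD1_seq m) //= mcoeffZ mcoeffX eqxx mulr1 big1 ?addr0 // => m' m'm.
    by rewrite mcoeffZ mcoeffX (negbTE m'm) mulr0.
  rewrite big_seq big1 // => m' m's; rewrite mcoeffZ mcoeffX.
  by case: eqP => [e|]; [rewrite -e m's in mNs|rewrite mulr0].
rewrite mcoeff_msupp mcoeffB coef_s; apply: contraNT => m_std.
case: ifPn => [_|mNs]; first by rewrite subrr.
by rewrite subr0 -[_ == 0]negbK -mcoeff_msupp; apply: contraNN mNs => /fs; apply.
Qed.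

Lemma coinv_standard_basis :
  is_basis (fun m => ~~ nonstandard p m) cmon (fun=> True).
Proof.
split=> // [s c s_uniq s_std|v _].
  by apply: coinv_standard_free => // m m' _ _.
have [f ->] : exists f, v = coinv p f.
  by exists (repr v); rewrite /coinv reprK.
exists [seq m <- msupp f | ~~ nonstandard p m], (fun m => f@_m).
have s_uniq := filter_uniq (fun m => ~~ nonstandard p m) (msupp_uniq f).
split=> //; first by move=> m; rewrite mem_filter => /andP[].
by apply: coinv_standard_span => // m mf m_std; rewrite mem_filter m_std.
Qed.

Definition standard_seq : seq 'X_{1..4} :=
  [seq std_mon 0 a b | a <- index_iota 0 (p - 1), b <- index_iota 0 p] ++
  [seq std_mon 1 a b | a <- index_iota 0 (p - 3), b <- index_iota 0 p].

Lemma mem_standard_seq m : (m \in standard_seq) = ~~ nonstandard p m.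
Proof.
have [e0 e1 e2 e3] := std_monE (m (inord 1)) (m (inord 2)) (m (inord 3)).
rewrite mem_cat; apply/idP/idP => [/orP[]/allpairsP[[a b] [/=]]|m_std].
- rewrite !mem_index_iota => a_lt b_lt ->; have [d0 d1 d2 d3] := std_monE 0 a b.
  by rewrite /nonstandard; lia.
- rewrite !mem_index_iota => a_lt b_lt ->; have [d0 d1 d2 d3] := std_monE 1 a b.
  by rewrite /nonstandard; lia.
have m0 : m (inord 0) = 0%N by move: m_std; rewrite /nonstandard; lia.
have -> : m = std_mon (m (inord 1)) (m (inord 2)) (m (inord 3)).
  by apply: mnm4P; rewrite ?e0 ?e1 ?e2 ?e3.
apply/orP; move: m_std; rewrite /nonstandard; case: (m (inord 1)) => [|[|k]] m_std; last by lia.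
  by left; apply: (allpairs_f (std_mon 0)); rewrite mem_index_iota; lia.
by right; apply: (allpairs_f (std_mon 1)); rewrite mem_index_iota; lia.
Qed.

Lemma standard_seq_uniq : uniq standard_seq.
Proof.
have uniq_c c k : uniq [seq std_mon c a b | a <- index_iota 0 k, b <- index_iota 0 p].
  apply: allpairs_uniq; rewrite ?iota_uniq // => -[a b] [a' b'] _ _ /=.
  by move/(@std_mon_inj c (a, b) (a', b')).
rewrite cat_uniq !uniq_c andbT /=; apply/hasPn => m /allpairsP[[a b] [_ _ ->]]; apply/negP.
move=> /allpairsP[[a' b'] [_ _ e]]; have [_ d1 _ _] := std_monE 1 a b.
by have [_ d'1 _ _] := std_monE 0 a' b'; move: d1; rewrite e d'1.
Qed.

(** Each of the two boxes gives a product of sums over the exponents of X_3 and X_4. The X_3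
    factors, the second one shifted by X_2, are 1 + ... + t^(p-2) and t + ... + t^(p-3). *)
Lemma standard_seq_series :
  \sum_(m <- standard_seq) 'X^(mdeg m) =
  (1 + (\sum_(1 <= i < p - 2) 'X^i) *+ 2 + 'X^(p - 2)) * \sum_(0 <= i < p) 'X^i
  :> {poly nat}.
Proof.
have deg c a b : mdeg (std_mon c a b) = (c + a + b)%N.
  by have [e0 e1 e2 e3] := std_monE c a b; rewrite mdeg4; lia.
have prod c k :
    \sum_(m <- [seq std_mon c a b | a <- index_iota 0 k, b <- index_iota 0 p]) 'X^(mdeg m) =
    (\sum_(0 <= a < k) 'X^(c + a)) * \sum_(0 <= b < p) 'X^b :> {poly nat}.
  rewrite big_allpairs_dep big_distrlr /=; apply: eq_bigr => a _; apply: eq_bigr => b _.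
  by rewrite deg exprD.
rewrite big_cat /= !prod -mulrDl; congr (_ * _).
rewrite (_ : p - 1 = (p - 2).+1)%N; last by lia.
rewrite big_nat_recr //= big_ltn; last by lia.
rewrite (_ : p - 3 = (p - 2).-1)%N; last by lia.
rewrite -(big_add1 _ _ 0 (p - 2) xpredT (fun i => 'X^i)) /= !add0n expr0.
by rewrite mulr2n addrA [RHS]addrAC addrAC -!addrA.
Qed.

Lemma coinv_hilbert_series :
  has_hilbert_series p F 4
    ((1 + (\sum_(1 <= i < p - 2) 'X^i) *+ 2 + 'X^(p - 2)) * \sum_(0 <= i < p) 'X^i).
Proof.
move=> d; rewrite -standard_seq_series.
pose S := [seq m <- standard_seq | mdeg m == d].
have S_uniq : uniq S := filter_uniq _ standard_seq_uniq.
(* The coefficient of t^d counts the standard monomials of degree d, which will index the basis in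
   that degree. *)
have -> : (\sum_(m <- standard_seq) 'X^(mdeg m) : {poly nat})`_d = size S.
  rewrite /S; elim: standard_seq => [|m s IH]; first by rewrite big_nil coef0.
  by rewrite big_cons coefD IH coefXn eq_sym /=; case: eqP.
have S_std m : m \in S -> ~~ nonstandard p m.
  by rewrite mem_filter mem_standard_seq => /andP[].
exists (fun i => cmon (nth 0%MM S i)); split=> [i _|s c s_uniq _|v [f homf ->]].
- exists 'X_[nth 0%MM S i] => //; rewrite dhomogX /=.
  by have := mem_nth 0%MM (ltn_ord i); rewrite mem_filter => /andP[].
- apply: coinv_standard_free => // [i j _ _ /eqP|i _]; last exact/S_std/mem_nth.
  by rewrite nth_uniq // => /eqP/val_inj.
exists (enum 'I_(size S)), (fun i : 'I_(size S) => f@_(nth 0%MM S i)); split=> //.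
  exact: enum_uniq.
rewrite (@coinv_standard_span _ S) //.
  by rewrite big_enum (big_nth 0%MM) big_mkord.
move=> m mf m_std; rewrite mem_filter mem_standard_seq m_std andbT.
by apply/eqP; apply: (dhomog_mf homf mf).
Qed.

End Coinvariants.

Theorem theorem4p2 (p : nat) (F : fieldType) :
  prime p -> (5 <= p)%N -> p \in [pchar F] ->
  let G := [:: X F 1; X F 2 ^+ 2; X F 2 * X F 3 ^+ (p - 3);
               X F 3 ^+ (p - 1); X F 4 ^+ p] in
  [/\ reduced_groebner_basis (@grevlex 4) (@hilbert_ideal p F 4) G,
      (forall m : 'X_{1..4}, standard_monomial (@grevlex 4) G m <->
         (m <= Xmon 3 *+ (p - 2) + Xmon 4 *+ (p - 1))%MM \/
         (m <= Xmon 2 + Xmon 3 *+ (p - 4) + Xmon 4 *+ (p - 1))%MM),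
      is_basis (standard_monomial (@grevlex 4) G)
        (fun m => coinv p ('X_[m] : {mpoly F[4]})) (fun=> True)
    & has_hilbert_series p F 4
        ((1 + (\sum_(1 <= i < p - 2) 'X^i) *+ 2 + 'X^(p - 2)) *
         \sum_(0 <= i < p) 'X^i)].
Proof.
move=> _ p_ge5 charFp G; split.
- exact: reduced_groebner_basis_hilbert_ideal.
- exact: standard_monomial_divides.
- have stdE m : standard_monomial (@grevlex 4) G m <-> ~~ nonstandard p m.
    exact: standard_monomialE.
  have [mem free span] := coinv_standard_basis p_ge5 charFp.
  split=> // [s c s_uniq s_std|v Uv].
    by apply: free => // m /s_std /stdE.
  have [s [c [s_uniq s_std ->]]] := span v Uv.
  by exists s, c; split=> // m /s_std ?; apply/stdE.
exact: coinv_hilbert_series.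
Qed.
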